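(* Let $\Sigma$ be a finite alphabet, $\lambda\in[0,1)$, and let $L=\mathcal{L}^{>\lambda}(\mathcal{A}|\mathrm{D})$ for some quantum automaton $\mathcal{A}$ over $\Sigma$. Then: (1) For any $w\in\Sigma^+$, $u\in\Sigma^*$ and $v\in\Sigma^\omega$, if $uv\in L$ then there are infinitely many positive integers $k$ such that $uw^kv\in L$. (2) For any $v\in L$, there are infinitely many finite prefixes $v_n$ of $v$ such that $v_nw^\omega\in L$ for all $w\in\Sigma^+$. (3) For any positive integer $n$, each $w\in L$ can be written as $w=xyz$ with $x,y\in\Sigma^*$, $z\in\Sigma^\omega$, such that $|x|\ge n$, $|y|\ge1$, and $xy^kz\in L$ for all $k\in\mathbb{N}$.
   Context: A quantum automaton is a tuple $\mathcal{A}=(\mathcal{H},|s_0\rangle,\Sigma,\{U_\sigma:\sigma\in\Sigma\},F)$ where $\mathcal{H}$ is a finite-dimensional complex Hilbert space, $|s_0\rangle$ a unit vector, $\Sigma$ a finite alphabet, each $U_\sigma$ unitary, and $F$ a subspace. For $w=\sigma_1\sigma_2\cdots\in\Sigma^\omega$, a unit vector $|\psi\rangle\in F$ and checkpoints $0\le n_1<n_2<\cdots$, the disturbing run is $|s_0\rangle$ (initial state) and for $n\ge1$: $|s_n\rangle=U_{\sigma_n}|\psi\rangle$ if $n-1=n_i$ for some $i$, else $|s_n\rangle=U_{\sigma_n}|s_{n-1}\rangle$. Then $f^{\mathrm{D}}_{\mathcal{A}}(w)=\sup_{|\psi\rangle}\sup_{\{n_i\}}\inf_{i\ge1}|\langle\psi|s_{n_i}\rangle|^2$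 (sup over unit $|\psi\rangle\in F$ and strictly increasing checkpoint sequences), and $\mathcal{L}^{>\lambda}(\mathcal{A}|\mathrm{D})=\{w\in\Sigma^\omega: f^{\mathrm{D}}_{\mathcal{A}}(w)>\lambda\}$. $|x|$ is the length of a finite word $x$. *)

(* Defs.v *)
From HB Require Import structures.
From mathcomp Require Import all_boot all_order all_algebra.
From mathcomp Require Import all_classical all_reals.
From mathcomp.real_closed Require Import complex.
Set Implicit Arguments. Unset Strict Implicit. Unset Printing Implicit Defensive.
Import Order.TTheory GRing.Theory Num.Theory.
Local Open Scope ring_scope.
Local Open Scope classical_set_scope.

Section QA.
Variable R : realType.
Local Notation C := R[i].

Definition sqmod (z : C) : R := let: Complex a b := z in a ^+ 2 + b ^+ 2.

Definition conjz (z : C) : C := let: Complex a b := z in Complex a (- b).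

Variable d : nat.

Definition inner (x y : 'cV[C]_d) : C := \sum_(j < d) conjz (x j 0) * y j 0.

Definition unit_vector (x : 'cV[C]_d) : Prop := \sum_(j < d) sqmod (x j 0) = 1.

Definition adjoint (A : 'M[C]_d) : 'M[C]_d := (map_mx conjz A)^T.

Definition unitary (A : 'M[C]_d) : Prop :=
  A *m adjoint A = 1%:M /\ adjoint A *m A = 1%:M.

(* x lies in the subspace F, given as the row space of the matrix F *)
Definition in_subspace (m : nat) (F : 'M[C]_(m, d)) (x : 'cV[C]_d) : bool :=
  (x^T <= F)%MS.

Variable Sigma : finType.

(* The disturbing run on the infinite word w (w n is the letter sigma_{n+1}),
   with probe state psi and checkpoints nck 0 < nck 1 < ... (nck i = n_{i+1}):
   s_0 = s0, s_{n+1} = U_{sigma_{n+1}} psi if n is a checkpoint,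
   else U_{sigma_{n+1}} s_n. *)
Fixpoint drun (s0 : 'cV[C]_d) (U : Sigma -> 'M[C]_d) (psi : 'cV[C]_d)
    (nck : nat -> nat) (w : nat -> Sigma) (n : nat) : 'cV[C]_d :=
  match n with
  | 0 => s0
  | n'.+1 => U (w n') *m (if n' \in range nck then psi else drun s0 U psi nck w n')
  end.

Definition strictly_increasing (nck : nat -> nat) : Prop :=
  forall i j, (i < j)%N -> (nck i < nck j)%N.

Definition fD (s0 : 'cV[C]_d) (U : Sigma -> 'M[C]_d) (m : nat) (F : 'M[C]_(m, d))
    (w : nat -> Sigma) : R :=
  sup [set r : R | exists (psi : 'cV[C]_d) (nck : nat -> nat),
         [/\ unit_vector psi, in_subspace F psi, strictly_increasing nck &
             r = inf [set sqmod (inner psi (drun s0 U psi nck w (nck i))) | i in [set: nat]]]].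

Definition LD (s0 : 'cV[C]_d) (U : Sigma -> 'M[C]_d) (m : nat) (F : 'M[C]_(m, d))
    (lambda : R) : set (nat -> Sigma) :=
  [set w | lambda < fD s0 U F w].

End QA.

Definition is_qautomaton (R : realType) (d : nat) (Sigma : finType)
    (s0 : 'cV[R[i]]_d) (U : Sigma -> 'M[R[i]]_d) : Prop :=
  unit_vector s0 /\ forall a, unitary (U a).

Section Words.
Variable Sigma : Type.
Definition catw (u : seq Sigma) (v : nat -> Sigma) : nat -> Sigma :=
  fun n => nth (v (n - size u)%N) u n.
Definition powf (w : seq Sigma) (k : nat) : seq Sigma := flatten (nseq k w).
Definition omegaw (a : Sigma) (w : seq Sigma) : nat -> Sigma :=
  fun n => nth a (a :: w) (n %% (size w).+1).
Definition prefixw (v : nat -> Sigma) (n : nat) : seq Sigma := mkseq v n.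
End Words.

(* Main.v *)
Require Import Defs.
From HB Require Import structures.
From mathcomp Require Import all_boot all_order all_algebra.
From mathcomp Require Import all_classical all_reals.
From mathcomp.real_closed Require Import complex.
From mathcomp Require Import zify ring lra.
Import Order.TTheory GRing.Theory Num.Theory.
Set Implicit Arguments. Unset Strict Implicit. Unset Printing Implicit Defensive.
Local Open Scope ring_scope.
Local Open Scope classical_set_scope.

(* Every checkpoint resets the state to psi, so a run is a sequence of independent
   segments, each leading from psi (or from the initial state) to a checkpoint.
   (1) For a unitary V and a vector x, infinitely many powers V^k bring x arbitrarily
   close to itself; inserting w^k for such k perturbs only the segment containing the
   insertion point, and only slightly.
   (2) After a checkpoint the state is psi, and some w^k almost fixes psi; placing a
   checkpoint after every k copies of w gives acceptance values close to 1 > lambda.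
   (3) Take for y the factor between two consecutive checkpoints: repeating or
   deleting this segment creates no new acceptance value. *)

(** * Squared norms, Bessel's inequality and stability of acceptance values *)

Section Hermitian.
Variables (R : realType) (d : nat).
Implicit Types (x y psi : 'cV[R[i]]_d) (z : R[i]).

Definition sqnorm x : R := \sum_(j < d) sqmod (x j 0).

Lemma sqmod_ge0 z : 0 <= sqmod z.
Proof. by case: z => a b /=; nra. Qed.

Lemma sqmod_le_sqnorm x j : sqmod (x j 0) <= sqnorm x.
Proof.
rewrite /sqnorm (bigD1 j) //= lerDl sumr_ge0 // => i _; exact: sqmod_ge0.
Qed.

Lemma conjz_mul z : conjz z * z = (sqmod z)%:C%C.
Proof. by case: z => a b; apply/eqP; rewrite eq_complex /=; apply/andP; split; apply/eqP; ring. Qed.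

Lemma inner_self x : inner x x = (sqnorm x)%:C%C.
Proof. by rewrite /inner /sqnorm rmorph_sum /=; apply: eq_bigr => j _; rewrite conjz_mul. Qed.

Lemma innerE x y : inner x y = ((map_mx (@conjz R) x)^T *m y) 0 0.
Proof. by rewrite mxE; apply: eq_bigr => j _; rewrite !mxE. Qed.

Lemma innerD x y1 y2 : inner x (y1 + y2) = inner x y1 + inner x y2.
Proof. by rewrite !innerE mulmxDr mxE. Qed.

Lemma sqnorm_unitary (A : 'M[R[i]]_d) x : unitary A -> sqnorm (A *m x) = sqnorm x.
Proof.
move=> [_ AA]; suff: inner (A *m x) (A *m x) = inner x x.
  by rewrite !inner_self => -[].
rewrite !innerE -[map_mx _ (A *m x)]/(map_mx (@conjc R) (A *m x)) map_mxM trmx_mul -!mulmxA (mulmxA _ A).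
by rewrite -[_^T *m A]/(adjoint A *m A) AA mul1mx.
Qed.

Lemma sqmodB_mul z c p : sqmod (z - c * p) =
  sqmod z - 2 * complex.Re (conjz c * (conjz p * z)) + sqmod c * sqmod p.
Proof. by case: z c p => [a b] [c c'] [p p'] /=; ring. Qed.

(* Bessel's inequality: expand [0 <= |y - <psi,y> psi|^2]. *)
Lemma sqmod_inner_le psi y : unit_vector psi -> sqmod (inner psi y) <= sqnorm y.
Proof.
move=> psi1; set c := inner psi y.
have : 0 <= \sum_(j < d) sqmod (y j 0 - c * psi j 0).
  by apply: sumr_ge0 => j _; exact: sqmod_ge0.
under eq_bigr do rewrite sqmodB_mul.
rewrite big_split /= sumrB -!mulr_sumr psi1 mulr1.
have ReD : {morph @complex.Re R : u v / u + v} by case=> ? ? [].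
rewrite -(big_morph (@complex.Re R) ReD (erefl _ : complex.Re 0 = 0)) -mulr_sumr.
by rewrite -/(inner psi y) -/c conjz_mul /= -/(sqnorm y); lra.
Qed.

Lemma unit_sqmod_inner psi : unit_vector psi -> sqmod (inner psi psi) = 1.
Proof. by move=> psi1; rewrite inner_self {1}/sqnorm psi1 /=; ring. Qed.

(** Put c = <psi,y> and b = <psi,y-x>. Bessel gives |c|^2 <= 1 and |b|^2 <= |y-x|^2, and Young's
    inequality gives |c-b|^2 <= (1 + eta/2)|c|^2 + (1 + 2/eta)|b|^2; [delta] makes the last term at
    most eta/2. *)
Lemma sqmod_inner_stable psi (eta : R) : unit_vector psi -> 0 < eta ->
  exists2 delta, 0 < delta & forall x y, sqnorm y <= 1 ->
    sqnorm (y - x) <= delta -> sqmod (inner psi x) - eta <= sqmod (inner psi y).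
Proof.
move=> psi1 eta0; exists ((eta / 2) / (1 + 2 / eta)).
  by rewrite !divr_gt0 // addr_gt0 // divr_gt0.
move=> x y y1; rewrite ler_pdivlMr ?addr_gt0 ?divr_gt0 // => xy.
have {y1} := le_trans (sqmod_inner_le y psi1) y1.
have {xy} : sqmod (inner psi (y - x)) * (1 + 2 / eta) <= eta / 2.
  apply: le_trans xy; rewrite ler_wpM2r ?sqmod_inner_le //.
  by rewrite addr_ge0 // divr_ge0 // ltW.
have -> : inner psi y = inner psi x + inner psi (y - x).
  by rewrite -innerD addrC subrK.
case: (inner psi x) (inner psi (y - x)) => [a a'] [b b'] /=.
set t := 2 / eta; have t0 : 0 < t by rewrite divr_gt0.
have teta : t * eta = 2 by rewrite /t divfK ?gt_eqF.
set c := a + b; set c' := a' + b'.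
have -> : a = c - b by rewrite /c; ring.
have -> : a' = c' - b' by rewrite /c'; ring.
move=> H cc; clearbody c c' t.
have e2 : eta / 2 * t = 1 by rewrite mulrAC (mulrC eta) teta divff ?pnatr_eq0.
(* Young's inequality, from (u + t v)^2 >= 0 and eta/2 * t = 1. *)
have sq (u v : R) : - 2 * u * v <= eta / 2 * u ^+ 2 + t * v ^+ 2.
  have -> : eta / 2 * u ^+ 2 + t * v ^+ 2 =
    eta / 2 * (u + t * v) ^+ 2 - 2 * (eta / 2 * t) * u * v
      + t * v ^+ 2 * (1 - eta / 2 * t) by ring.
  rewrite e2 subrr mulr0 addr0 mulr1.
  suff : 0 <= eta / 2 * (u + t * v) ^+ 2 by lra.
  by rewrite mulr_ge0 ?sqr_ge0 // divr_ge0 // ltW.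
have := sq c b; have := sq c' b'; have : eta / 2 * (c ^+ 2 + c' ^+ 2) <= eta / 2.
  by rewrite ler_piMr // divr_ge0 // ltW.
by rewrite mulrDr mulr1 in H *; nra.
Qed.

End Hermitian.

(** * Recurrence of isometries on a bounded orbit *)

Section Recurrence.
Variables (R : realType) (d : nat).
Implicit Types (x y : 'cV[R[i]]_d).

(** Grid of mesh 1/M on [-1,1]; the endpoint a = 1 has index 2M, hence 2M + 1 cells. *)
Definition cell (M : nat) (a : R) : 'I_((2 * M).+1) :=
  inord (Num.truncn ((a + 1) * M%:R)).

(** Equal truncations force |a - b| M < 1; the weaker bound 1/M on the square is enough for the
    pigeonhole argument. *)
Lemma cell_close M (a b : R) : (0 < M)%N -> a ^+ 2 <= 1 -> b ^+ 2 <= 1 ->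
  cell M a = cell M b -> (a - b) ^+ 2 <= M%:R^-1.
Proof.
move=> M0 a1 b1 /(congr1 val); have M0' : 1 <= M%:R :> R by rewrite ler1n.
have bnd (c : R) : c ^+ 2 <= 1 -> 0 <= (c + 1) * M%:R <= 2 * M%:R.
  by move=> c1; apply/andP; split; nra.
have trunc_lt (c : R) : c ^+ 2 <= 1 -> (Num.truncn ((c + 1) * M%:R) < (2 * M).+1)%N.
  move=> /bnd /andP[c0 c2]; rewrite truncn_lt_nat // -natr1 natrM.
  by rewrite (le_lt_trans c2) // ltrDl.
rewrite /= !inordK ?trunc_lt // => eab.
have /andP[/truncn_itv/andP[al ar] _] := bnd a a1.
have /andP[/truncn_itv/andP[bl br] _] := bnd b b1.
move: al ar bl br; rewrite eab -natr1; set T := _%:R => al ar bl br.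
have h1 : (a - b) * M%:R < 1 by nra.
have h2 : - 1 < (a - b) * M%:R by nra.
rewrite -[X in _ <= X]mul1r ler_pdivlMr; last by lra.
have : ((a - b) * M%:R) ^+ 2 <= 1 by nra.
by nra.
Qed.

Definition cell_code M x : {ffun 'I_d -> 'I_((2 * M).+1) * 'I_((2 * M).+1)} :=
  [ffun j => (cell M (complex.Re (x j 0)), cell M (complex.Im (x j 0)))].

Lemma cell_code_close M x y : (0 < M)%N -> sqnorm x <= 1 -> sqnorm y <= 1 ->
  cell_code M x = cell_code M y -> sqnorm (x - y) <= (2 * d)%:R / M%:R.
Proof.
move=> M0 x1 y1 exy.
have -> : (2 * d)%:R / M%:R = \sum_(j < d) (2 / M%:R : R).
  by rewrite sumr_const card_ord -[_ *+ d]mulr_natl natrM; ring.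
apply: ler_sum => j _.
have := congr1 (fun g : {ffun _} => g j) exy; rewrite !ffunE !mxE.
have := le_trans (sqmod_le_sqnorm x j) x1.
have := le_trans (sqmod_le_sqnorm y j) y1.
case: (x j 0) (y j 0) => [a a'] [b b'] /= nb na [/(cell_close M0) cre /(cell_close M0) cim].
have := cre _ _; have := cim _ _; set m := M%:R^-1 => h1 h2.
have := h2 ltac:(nra) ltac:(nra); have := h1 ltac:(nra) ltac:(nra).
by lra.
Qed.

(* Pigeonhole: two iterates in the same cell of a fine grid are close, and
   the isometry property lets one cancel the smaller exponent. *)
Lemma isometry_recurrence (f : 'cV[R[i]]_d -> 'cV[R[i]]_d) x (delta : R) (N : nat) :
  (forall y1 y2, sqnorm (f y1 - f y2) = sqnorm (y1 - y2)) ->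
  (forall k, sqnorm (iter k f x) <= 1) -> 0 < delta ->
  exists2 k, (N < k)%N & sqnorm (iter k f x - x) <= delta.
Proof.
move=> f_iso x1 delta0.
pose M := (Num.truncn ((2 * d)%:R / delta)).+1.
have MP : (2 * d)%:R / M%:R <= delta.
  rewrite ler_pdivrMr ?ltr0n // mulrC -ler_pdivrMr //.
  by have /andP[_ /ltW] := truncn_itv (divr_ge0 (ler0n R (2 * d)) (ltW delta0)).
pose T := {ffun 'I_d -> 'I_((2 * M).+1) * 'I_((2 * M).+1)}.
(* Sampling at multiples of N + 1 makes the difference of any two distinct exponents exceed N. *)
pose g (i : 'I_#|T|.+1) : T := cell_code M (iter (i * N.+1) f x).
have iter_iso n y1 y2 : sqnorm (iter n f y1 - iter n f y2) = sqnorm (y1 - y2).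
  by elim: n => //= n IHn; rewrite f_iso.
have close (i j : 'I_#|T|.+1) : (i < j)%N -> g i = g j ->
    exists2 k, (N < k)%N & sqnorm (iter k f x - x) <= delta.
  move=> ij gij; exists ((j - i) * N.+1)%N.
    by rewrite (leq_trans (ltnSn N)) // leq_pmull // subn_gt0.
  rewrite -(iter_iso (i * N.+1)%N) -iterD -mulnDl subnKC ?(ltnW ij) //.
  by apply: le_trans MP; apply: cell_code_close.
have /injectivePn[i [j nij gij]] : ~~ injectiveb g.
  by apply/negP => /injectiveP/leq_card; rewrite card_ord ltnn.
have [ij|ji|/val_inj ij] := ltngtP i j; last by rewrite ij eqxx in nij.
- exact: close gij.
- exact: close (esym gij).
Qed.

End Recurrence.

(** * Concatenation, powers and periodic words *)

Section Words.
Variable Sigma : Type.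
Implicit Types (u w : seq Sigma) (v : nat -> Sigma).

Lemma catw_ltn u v n : (n < size u)%N -> catw u v n = nth (v 0%N) u n.
Proof. by move=> nu; rewrite /catw; apply: set_nth_default. Qed.

Lemma catw_addn u v n : catw u v (size u + n)%N = v n.
Proof. by rewrite /catw nth_default ?leq_addr // addKn. Qed.

Lemma catw_cat u1 u2 v : catw (u1 ++ u2) v = catw u1 (catw u2 v).
Proof.
apply/funext => n; have [n1|n1] := ltnP n (size u1).
  have n2 : (n < size (u1 ++ u2))%N by rewrite size_cat ltn_addr.
  by rewrite (catw_ltn _ n1) catw_ltn // nth_cat n1; exact: set_nth_default.
rewrite -(subnKC n1) catw_addn; have [n2|n2] := ltnP (n - size u1) (size u2).
  rewrite !catw_ltn ?size_cat ?ltn_add2l // nth_cat ltnNge leq_addr /=.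
  by rewrite addKn; apply: set_nth_default.
by rewrite -(subnKC n2) addnA -size_cat !catw_addn.
Qed.

Lemma catw0 v : catw [::] v = v.
Proof. by apply/funext => n; rewrite /catw /= nth_nil subn0. Qed.

Lemma size_prefixw v n : size (prefixw v n) = n.
Proof. exact: size_mkseq. Qed.

Lemma catw_prefixw_addn (w v : nat -> Sigma) n i : catw (prefixw w n) v (n + i)%N = v i.
Proof. by have := catw_addn (prefixw w n) v i; rewrite size_prefixw. Qed.

Lemma catw_prefixw v n : catw (prefixw v n) (fun i => v (n + i)%N) = v.
Proof.
apply/funext => i; have [ni|ni] := ltnP i n.
  by rewrite catw_ltn ?size_prefixw // nth_mkseq.
by rewrite -{1}(subnKC ni) catw_prefixw_addn subnKC.
Qed.

Lemma prefixw_catw u v : prefixw (catw u v) (size u) = u.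
Proof.
apply: (@eq_from_nth _ (v 0%N)); rewrite size_prefixw // => i iu.
by rewrite nth_mkseq // catw_ltn.
Qed.

Lemma powfS w k : powf w k.+1 = w ++ powf w k. Proof. by []. Qed.

Lemma size_powf w k : size (powf w k) = (k * size w)%N.
Proof. by elim: k => // k IHk; rewrite powfS size_cat IHk mulSn. Qed.

Lemma omegaw_catw a w : omegaw a w = catw (a :: w) (omegaw a w).
Proof.
apply/funext => n; have [nw|nw] := ltnP n (size w).+1.
  by rewrite catw_ltn // /omegaw modn_small //; apply: set_nth_default.
by rewrite -{2}(subnKC nw) (catw_addn (a :: w)) -{1}(subnKC nw) /omegaw modnDl.
Qed.

Lemma omegaw_powf a w k : omegaw a w = catw (powf (a :: w) k) (omegaw a w).
Proof.
elim: k => [|k IHk]; first by rewrite catw0.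
by rewrite powfS catw_cat -IHk -omegaw_catw.
Qed.

End Words.

(** * Runs and acceptance for a fixed probe state *)

Section Run.
Variables (R : realType) (d : nat) (Sigma : finType).
Variables (U : Sigma -> 'M[R[i]]_d) (psi : 'cV[R[i]]_d).
Implicit Types (s : 'cV[R[i]]_d) (P Q : pred nat) (v w : nat -> Sigma) (r : R).

(* [drun] with the checkpoint sequence replaced by its set of values. *)
Fixpoint run s P w n : 'cV[R[i]]_d :=
  if n is n'.+1 then U (w n') *m (if P n' then psi else run s P w n') else s.

Definition evol (u : seq Sigma) s := foldl (fun x a => U a *m x) s u.

Lemma evol_powf u k s : evol (powf u k) s = iter k (evol u) s.
Proof. by elim: k s => // k IHk s; rewrite powfS /evol foldl_cat -/(evol _ _) IHk -iterSr. Qed.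

Lemma eq_run s P Q v w n : (forall i, (i < n)%N -> P i = Q i) ->
  (forall i, (i < n)%N -> v i = w i) -> run s P v n = run s Q w n.
Proof.
elim: n => //= n IHn PQ vw; rewrite PQ // vw // IHn // => i /ltnW; [exact: PQ|exact: vw].
Qed.

(** A checkpoint at 0 only replaces psi by psi, so agreement is asked at positive positions. *)
Lemma eq_run_psi P Q v w n : (forall i, (0 < i < n)%N -> P i = Q i) ->
  (forall i, (i < n)%N -> v i = w i) -> run psi P v n = run psi Q w n.
Proof.
elim: n => //= n IHn PQ vw; rewrite vw // IHn.
- by case: n {IHn vw} PQ => [|n] PQ /=; [rewrite !if_same|rewrite PQ ?ltnSn].
- by move=> i /andP[i0 /ltnW it]; apply: PQ; rewrite i0.
- by move=> i /ltnW; exact: vw.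
Qed.

(** For n = 0 the left side is the state before a reset at [a], the right side the state after it;
    hence 0 < n. *)
Lemma run_shift s P w a n : (0 < n)%N -> run s P w (a + n) =
  run (if P a then psi else run s P w a) (fun i => P (a + i)%N) (fun i => w (a + i)%N) n.
Proof.
case: n => // n _; elim: n => [|n IHn]; first by rewrite addn1 /= addn0; case: ifP.
by rewrite addnS [LHS]/= IHn.
Qed.

Lemma run_free s P w n : (forall i, (i < n)%N -> ~~ P i) ->
  run s P w n = evol (prefixw w n) s.
Proof.
elim: n => // n IHn nP; rewrite [LHS]/= (negbTE (nP _ _)) // IHn; last by move=> i /ltnW/nP.
by rewrite /evol /prefixw mkseqS foldl_rcons.
Qed.

Definition unbounded P := forall N, exists2 n, (N <= n)%N & P n.

(** The lower bound r replaces the infimum over checkpoints, and a set of positions replaces their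
    enumeration. *)
Definition accepts r s w := exists2 P, unbounded P &
  forall n, P n -> r <= sqmod (inner psi (run s P w n)).

Lemma accepts_glue r s P w a v : P a ->
  (forall n, (n <= a)%N -> P n -> r <= sqmod (inner psi (run s P w n))) ->
  accepts r psi v -> accepts r s (catw (prefixw w a) v).
Proof.
move=> Pa P_ok [Q Q_inf Q_ok].
exists (fun n => if (n <= a)%N then P n else Q (n - a)%N).
  move=> N; have [n Nn Qn] := Q_inf N.+1; exists (a + n)%N; first by lia.
  by rewrite ifN ?addKn //; lia.
move=> n; case: ifPn => [na Pn|].
  rewrite (@eq_run s _ P _ w); first exact: P_ok.
    by move=> i it; rewrite ifT //; lia.
  by move=> i it; rewrite catw_ltn ?size_prefixw ?nth_mkseq //; lia.
rewrite -ltnNge => an Qn.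
have -> : n = (a + (n - a))%N by lia.
rewrite run_shift ?subn_gt0 // leqnn Pa (@eq_run_psi _ Q _ v); first exact: Q_ok.
  by move=> i it; rewrite ifN ?addKn //; lia.
by move=> i it; rewrite catw_prefixw_addn.
Qed.

Lemma accepts_tail r s P w a : unbounded P ->
  (forall n, P n -> r <= sqmod (inner psi (run s P w n))) -> P a ->
  accepts r psi (fun i => w (a + i)%N).
Proof.
move=> P_inf P_ok Pa; exists (fun i => (0 < i)%N && P (a + i)%N).
  move=> N; have [n Nn Pn] := P_inf (a + N.+1)%N; exists (n - a)%N; first by lia.
  by rewrite subnKC ?Pn ?andbT; lia.
move=> n /andP[n0 /P_ok]; rewrite run_shift // Pa.
by rewrite (@eq_run_psi _ (fun i => (0 < i)%N && P (a + i)%N) _ (fun i => w (a + i)%N)) // => i /andP[->].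
Qed.

Lemma accepts_segment r s u v : r <= sqmod (inner psi (evol u s)) ->
  accepts r psi v -> accepts r s (catw u v).
Proof.
move=> ru vP; rewrite -{1}(prefixw_catw u v).
apply: (@accepts_glue _ _ (pred1 (size u))) => //=.
move=> n _ /eqP ->; rewrite run_free ?prefixw_catw //.
by move=> i; rewrite /= ltn_neqAle => /andP[].
Qed.

(** With checkpoints at the positive multiples of |u|, every segment reads [u] from psi and yields
    the same value. *)
Lemma accepts_periodic r u v : (0 < size u)%N -> v = catw u v ->
  r <= sqmod (inner psi (evol u psi)) -> accepts r psi v.
Proof.
move=> u0 uv ru; pose P n := (0 < n)%N && (size u %| n)%N.
have v_per j i : v (j * size u + i)%N = v i.
  by elim: j => // j IHj; rewrite mulSn -addnA {1}uv catw_addn.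
have P_lt i : (0 < i < size u)%N -> ~~ P i.
  by move=> /andP[i0 iu]; rewrite /P i0 /= gtnNdvd.
have P_per j i : (0 < i)%N -> P (j * size u + i)%N = P i.
  by move=> i0; rewrite /P dvdn_addr ?dvdn_mull // i0 addn_gt0 i0 orbT.
exists P.
  move=> N; exists (N.+1 * size u)%N; first by rewrite (leq_trans (leqnSn N)) // leq_pmulr.
  by rewrite /P muln_gt0 u0 dvdn_mull.
move=> n /andP[n0 /dvdnP[[|j] nE]]; first by rewrite nE in n0.
rewrite {}nE mulSnr run_shift //.
have -> : (if P (j * size u)%N then psi else run psi P v (j * size u)) = psi.
  by case: j => [|j]; rewrite ?if_same // /P muln_gt0 u0 dvdn_mull.
rewrite (@eq_run_psi _ pred0 _ v) // => [|i /andP[i0 iu]].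
  by rewrite run_free // uv prefixw_catw.
by rewrite P_per //; apply: negbTE; apply: P_lt; rewrite i0.
Qed.

Lemma accepts_powf r u v k : r <= sqmod (inner psi (evol u psi)) ->
  accepts r psi v -> accepts r psi (catw (powf u k) v).
Proof.
move=> ru vP; elim: k => [|k IHk]; first by rewrite catw0.
by rewrite powfS catw_cat; apply: accepts_segment.
Qed.

Lemma next_checkpoint P a : unbounded P ->
  exists b, [/\ (a < b)%N, P b & forall i, (a < i < b)%N -> ~~ P i].
Proof.
move=> P_inf; have ex : exists b, (a < b)%N && P b.
  by have [n an Pn] := P_inf a.+1; exists n; rewrite an.
case: (ex_minnP ex) => b /andP[ab Pb] bmin; exists b; split=> // i /andP[ai ib].
by apply/negP => Pi; have := bmin i; rewrite ai Pi leqNgt ib => /(_ isT).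
Qed.

(** Iterate the next-checkpoint map from the least element of [P]; no element can be skipped. *)
Lemma unbounded_enum P : unbounded P ->
  exists2 nck, strictly_increasing nck & forall n, (n \in range nck) = P n.
Proof.
move=> P_inf; have [next nextP] := choice (fun a => next_checkpoint a P_inf).
have ex0 : exists n, P n by have [n _ Pn] := P_inf 0%N; exists n.
case: (ex_minnP ex0) => b Pb bmin.
exists (fun i => iter i next b).
  move=> i j; elim: j => // j IHj; rewrite ltnS leq_eqVlt => /predU1P[->|/IHj ij].
    by have [] := nextP (iter j next b).
  by apply: ltn_trans ij _; have [] := nextP (iter j next b).
move=> n; apply/idP/idP => [|Pn].
  by rewrite inE => -[[|i] _ <-] //=; have [] := nextP (iter i next b).
rewrite inE; have grow k : (k <= iter k next b)%N.
  by elim: k => // k IHk; apply: leq_ltn_trans IHk _; have [] := nextP (iter k next b).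
(* The iterate just before the first one beyond n must equal n, as no element of [P] lies strictly
   between the two. *)
have [k nk kmin] : exists2 k, (n < iter k next b)%N &
    forall j, (n < iter j next b)%N -> (k <= j)%N.
  by case: (@ex_minnP (fun k => n < iter k next b)%N) => [|k]; [exists n.+1; exact: grow|exists k].
case: k nk kmin => [|k] nk kmin.
  by have := leq_ltn_trans (bmin _ Pn) nk; rewrite ltnn.
exists k => //; have kn : (iter k next b <= n)%N.
  by rewrite leqNgt; apply/negP => /kmin; rewrite ltnn.
apply/eqP; rewrite eqn_leq kn leqNgt; apply/negP => kn'.
by have [_ _ /(_ n)] := nextP (iter k next b); rewrite kn' nk Pn => /(_ isT).
Qed.

(** * Recurrence under unitary evolution and its effect on acceptance *)

Hypothesis U_unitary : forall a, unitary (U a).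

Lemma evol_isometry u x y : sqnorm (evol u x - evol u y) = sqnorm (x - y).
Proof.
elim: u x y => //= a u IHu x y; rewrite -/(evol _ _) -/(evol u (U a *m y)) IHu.
by rewrite -mulmxBr sqnorm_unitary.
Qed.

Lemma sqnorm_evol u x : sqnorm (evol u x) = sqnorm x.
Proof. by elim: u x => //= a u IHu x; rewrite -/(evol _ _) IHu sqnorm_unitary. Qed.

Lemma evol_recurrence u x (delta : R) N : sqnorm x <= 1 -> 0 < delta ->
  exists2 k, (N < k)%N & sqnorm (evol (powf u k) x - x) <= delta.
Proof.
move=> x1 delta0; have [||k Nk xk] := @isometry_recurrence _ _ (evol u) x _ N _ _ delta0.
- exact: evol_isometry.
- by move=> k; rewrite -evol_powf sqnorm_evol.
- by exists k; rewrite // evol_powf.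
Qed.

Hypothesis psi1 : unit_vector psi.

Lemma sqnorm_run s P w n : unit_vector s -> sqnorm (run s P w n) = 1.
Proof. by move=> s1; elim: n => //= n IHn; rewrite sqnorm_unitary //; case: ifP. Qed.

(** Some power of the word brings psi back so close to itself that the value drops from <psi,psi> =
    1 by at most 1 - r; that power serves as the period between checkpoints. *)
Lemma accepts_omegaw r a (w : seq Sigma) : r < 1 -> accepts r psi (omegaw a w).
Proof.
move=> r1; have eta0 : 0 < 1 - r by rewrite subr_gt0.
have [delta delta0 stable] := sqmod_inner_stable psi1 eta0.
have psi1' : sqnorm psi <= 1 by rewrite /sqnorm psi1.
have [k k0 close] := evol_recurrence (a :: w) 0 psi1' delta0.
apply: (@accepts_periodic _ (powf (a :: w) k)).
- by rewrite size_powf muln_gt0 k0.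
- exact: omegaw_powf.
- have := stable psi (evol (powf (a :: w) k) psi).
  by rewrite sqnorm_evol unit_sqmod_inner // subKr; apply.
Qed.

(* Once [u] almost fixes the state reached at the insertion point, unitarity
   keeps the shifted run close to the original one until the next checkpoint,
   after which they coincide. *)
Lemma accepts_insert r r' s x u v N : unit_vector s -> (0 < size u)%N -> r' < r ->
  accepts r s (catw x v) ->
  exists2 k, (N < k)%N & accepts r' s (catw (x ++ powf u k) v).
Proof.
move=> s1 u0 rr' [P P_inf P_ok]; set w := catw x v in P_ok *; set p := size x.
have eta0 : 0 < r - r' by rewrite subr_gt0.
have [delta delta0 stable] := sqmod_inner_stable psi1 eta0.
have b1 : sqnorm (run s P w p) <= 1 by rewrite sqnorm_run.
have [k Nk close] := evol_recurrence u N b1 delta0.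
exists k => //; set l := size (powf u k).
have l0 : (0 < l)%N by rewrite /l size_powf muln_gt0 u0 (leq_ltn_trans (leq0n N)).
set w' := catw _ v.
(* A checkpoint at p itself moves to p + l, so the inserted block acts on the state before that
   reset. *)
pose Q n := if (n < p)%N then P n else (p + l <= n)%N && P (n - l)%N.
have run_lt n : (n <= p)%N -> run s Q w' n = run s P w n.
  move=> np; apply: eq_run => i it; first by rewrite /Q ifT //; lia.
  have ip : (i < size x)%N by rewrite -/p; lia.
  by rewrite /w' /w catw_cat !(catw_ltn _ ip); exact: set_nth_default.
have Q_ge n : Q (p + l + n)%N = P (p + n)%N.
  rewrite /Q ifN ?leq_addr /=; last by lia.
  by congr (P _); lia.
have Q_mid i : (i < l)%N -> Q (p + i)%N = false.
  by move=> il; rewrite /Q ltnNge leq_addr leq_add2l leqNgt il.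
have run_ge n : sqnorm (run s Q w' (p + l + n) - run s P w (p + n)) <= delta.
  elim: n => [|n IHn].
    have Qp : Q p = false by rewrite -[p in Q p]addn0 Q_mid.
    rewrite !addn0 run_shift // Qp run_lt // run_free => [|i il].
      rewrite -[l]/(size (powf u k)).
      rewrite (_ : (fun i => w' (p + i)%N) = catw (powf u k) v) ?prefixw_catw //.
      by apply/funext => i; rewrite /w' catw_cat catw_addn.
    by rewrite Q_mid.
  rewrite !addnS /= Q_ge.
  have -> : w' (p + l + n)%N = w (p + n)%N.
    by rewrite /w /w' catw_addn /p /l -size_cat catw_addn.
  rewrite -mulmxBr sqnorm_unitary //; case: ifP => // _.
  rewrite subrr /sqnorm big1 ?ltW // => j _; rewrite mxE /=; ring.
exists Q.
  move=> M; have [n Mn Pn] := P_inf (p + M)%N; exists (p + l + (n - p))%N; first by lia.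
  by rewrite Q_ge subnKC //; lia.
move=> n; have [np|pn] := ltnP n p.
  rewrite /Q np => /P_ok; rewrite run_lt ?(ltnW np) //.
  by apply: le_trans; rewrite ltW.
move=> Qn; have [pln Pn] : (p + l <= n)%N /\ P (n - l)%N.
  by apply/andP; move: Qn; rewrite /Q ltnNge pn.
have := run_ge (n - (p + l))%N; rewrite subnKC // => /stable.
rewrite sqnorm_run // => /(_ (lexx _)).
rewrite (_ : (p + (n - (p + l)))%N = (n - l)%N); last by lia.
by have := P_ok _ Pn; lra.
Qed.

End Run.

(** * Membership in the language as acceptance above the threshold *)

Section Language.
Variables (R : realType) (d m : nat) (Sigma : finType).
Variables (s0 : 'cV[R[i]]_d) (U : Sigma -> 'M[R[i]]_d) (F : 'M[R[i]]_(m, d)).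
Implicit Types (w : nat -> Sigma) (lambda r : R).

Lemma drunE psi nck w n :
  drun s0 U psi nck w n = run U psi s0 (fun i => i \in range nck) w n.
Proof. by elim: n => //= n ->. Qed.

Lemma LD_accepts lambda w : 0 <= lambda < 1 -> LD s0 U F lambda w ->
  exists psi r, [/\ unit_vector psi, in_subspace F psi, lambda < r < 1 &
    accepts U psi r s0 w].
Proof.
move=> /andP[lam0 lam1]; rewrite /LD /= /fD; set E := (X in sup X) => lamE.
(* The supremum of the empty set is 0 by convention, which 0 <= lambda excludes. *)
have E0 : E !=set0.
  by apply/set0P/eqP => E0; move: lamE; rewrite E0 sup0 ltNge lam0.
have [r [psi [nck [psi1 psiF nck_inc rE]]] lamr] := sup_gt E0 lamE.
(* Capping by the midpoint of lambda and 1 keeps the bound below 1, as approximating psi in (2)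
   requires. *)
exists psi, (Num.min r ((1 + lambda) / 2)); split=> //.
  by rewrite lt_min lamr gt_min; apply/andP; split; [|apply/orP; right]; lra.
exists (fun i => i \in range nck).
  move=> N; exists (nck N); last by rewrite inE; exists N.
  by elim: N => // N IHN; apply: leq_ltn_trans IHN _; exact: nck_inc.
move=> n; rewrite inE => -[i _ <-]; rewrite -drunE ge_min; apply/orP; left.
rewrite rE; apply: ge_inf; last by exists i.
by exists 0 => _ [j _ <-]; exact: sqmod_ge0.
Qed.

Lemma accepts_LD lambda psi r w : is_qautomaton s0 U -> unit_vector psi ->
  in_subspace F psi -> lambda < r -> accepts U psi r s0 w -> LD s0 U F lambda w.
Proof.
move=> [s01 U_unitary] psi1 psiF lamr [P P_inf P_ok].
have [nck nck_inc nckP] := unbounded_enum P_inf.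
have nckE : (fun i => i \in range nck) = P by apply/funext.
apply: (lt_le_trans lamr); rewrite /fD; set E := (X in sup X).
(* Bessel bounds every value by 1, so the supremum dominates each member of [E]. *)
have E_ub : has_ubound E.
  exists 1 => _ [phi [nck' [phi1 _ _ ->]]].
  apply: (@le_trans _ _ (sqmod (inner phi (drun s0 U phi nck' w (nck' 0%N))))).
    apply: ge_inf; last by exists 0%N.
    by exists 0 => _ [j _ <-]; exact: sqmod_ge0.
  by rewrite (le_trans (sqmod_inner_le _ phi1)) // drunE sqnorm_run.
apply: le_trans (ub_le_sup E_ub _); last by exists psi, nck; split.
apply: lb_le_inf; first by exists (sqmod (inner psi (drun s0 U psi nck w (nck 0%N)))), 0%N.
move=> _ [i _ <-]; rewrite drunE nckE; apply: P_ok.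
by rewrite -nckP inE; exists i.
Qed.

End Language.

(** * The three pumping properties *)

Theorem theorem4 (R : realType) (Sigma : finType) (lambda : R)
    (d : nat) (s0 : 'cV[R[i]]_d) (U : Sigma -> 'M[R[i]]_d)
    (m : nat) (F : 'M[R[i]]_(m, d)) :
  is_qautomaton s0 U ->
  0 <= lambda < 1 ->
  let L := LD s0 U F lambda in
  (* (1) pumping inside *)
  (forall (w : seq Sigma) (u : seq Sigma) (v : nat -> Sigma),
      (0 < size w)%N -> L (catw u v) ->
      forall N : nat, exists k : nat, (N < k)%N /\ L (catw (u ++ powf w k) v))
  /\
  (* (2) infinitely many prefixes v_n with v_n w^omega in L for all w in Sigma^+ *)
  (forall v : nat -> Sigma, L v ->
      forall N : nat, exists n : nat, (N <= n)%N /\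
        forall (a : Sigma) (w : seq Sigma), L (catw (prefixw v n) (omegaw a w)))
  /\
  (* (3) pumping decomposition *)
  (forall n : nat, (0 < n)%N -> forall w : nat -> Sigma, L w ->
      exists (x y : seq Sigma) (z : nat -> Sigma),
        [/\ w = catw (x ++ y) z, (n <= size x)%N, (1 <= size y)%N &
            forall k : nat, L (catw (x ++ powf y k) z)]).
Proof.
move=> qa lamP L; have [s01 U_unitary] := qa.
split; [|split].
- move=> w u v w0 /(LD_accepts lamP)[psi [r [psi1 psiF /andP[lamr _] uvP]]] N.
  (* The midpoint leaves room for the small loss caused by the insertion. *)
  have /andP[lamr' r'r] : lambda < (lambda + r) / 2 < r by apply/andP; split; lra.
  have [k Nk kP] := accepts_insert U_unitary psi1 N s01 w0 r'r uvP.
  by exists k; split=> //; exact: accepts_LD kP.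
- move=> v /(LD_accepts lamP)[psi [r [psi1 psiF /andP[lamr r1] [P P_inf P_ok]]]] N.
  have [n Nn Pn] := P_inf N; exists n; split=> // a w.
  apply: (accepts_LD qa psi1 psiF lamr); apply: (accepts_glue Pn).
    by move=> j _; exact: P_ok.
  exact: accepts_omegaw.
- move=> n _ w /(LD_accepts lamP)[psi [r [psi1 psiF /andP[lamr _] [P P_inf P_ok]]]].
  have [a na Pa] := P_inf n; have [b [ab Pb nP]] := next_checkpoint a P_inf.
  pose y := prefixw (fun i => w (a + i)%N) (b - a); pose z i := w (b + i)%N.
  exists (prefixw w a), y, z; rewrite !size_prefixw subn_gt0; split=> //.
    rewrite catw_cat -[LHS](catw_prefixw w a) -[X in catw _ X](catw_prefixw _ (b - a)).
    by congr (catw _ (catw _ _)); apply/funext => i; rewrite addnA subnKC ?(ltnW ab).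
  move=> k; rewrite catw_cat; apply: (accepts_LD qa psi1 psiF lamr).
  apply: (accepts_glue Pa); first by move=> j _; exact: P_ok.
  apply: accepts_powf; last exact: accepts_tail P_inf P_ok Pb.
  (* Since [a] and [b] are consecutive checkpoints, the value at [b] is that of reading [y] from
     psi. *)
  have := P_ok _ Pb; rewrite -{1}(subnKC (ltnW ab)) run_shift ?subn_gt0 // Pa.
  rewrite (@eq_run_psi _ _ _ _ _ _ pred0 _ (fun i => w (a + i)%N)) ?run_free //.
  by move=> i iab; apply: negbTE; apply: nP; lia.
Qed.
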